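(* As formal power series in $u$ and $t$, $$\sum_{n\ge0}\frac{u^n}{(t;q)_{n+1}\,[\hat n]_{a,p}!}\sum_{\beta\in B_n}t^{\mathrm{des}_B(\beta)}q^{\mathrm{maj}(\beta)}p^{\ell_B(\beta)}a^{\mathrm{neg}(\beta)}=\sum_{k\ge0}t^k\prod_{j=0}^{k-1}e[q^ju]_p\cdot\hat e[q^ku]_{a,p}.$$
   Context: $B_n$ is the group of signed permutations of $[n]$ (bijections $\beta$ of $[-n,n]\setminus\{0\}$ with $\beta(-i)=-\beta(i)$), written $\beta=[\beta(1),\dots,\beta(n)]$; $B_0$ is the trivial group. $\mathrm{neg}(\beta)=|\{i:\beta(i)<0\}|$. $\mathrm{Des}_B(\beta)=\{i\in[0,n-1]:\beta(i)>\beta(i+1)\}$ with the natural order on integers and $\beta(0):=0$; $\mathrm{des}_B=|\mathrm{Des}_B|$, $\mathrm{maj}(\beta)=\sum_{i\in\mathrm{Des}_B(\beta)}i$. $\ell_B$ is the Coxeter length of $B_n$ with respect to the generators $s_i=[1,\dots,i-1,i+1,i,i+2,\dots,n]$ ($1\le i\le n-1$) and $s_0=[-1,2,\dots,n]$; equivalently $\ell_B(\beta)=\mathrm{inv}(\beta)-\sum_{i:\beta(i)<0}\beta(i)$, where $\mathrm{inv}(\beta)=|\{(i,j):1\le i<j\le n,\ \beta(i)>\beta(j)\}|$. Notation: $(x;p)_0=1$, $(x;p)_n=(1-x)(1-xp)\cdots(1-xp^{n-1})$; $[n]_p=1+p+\dots+p^{n-1}$, $[n]_p!=[n]_p[n-1]_p\cdots[1]_p$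 with $[0]_p!=1$; $[\hat n]_{a,p}!=(-ap;p)_n[n]_p!$; $e[u]_p=\sum_{n\ge0}u^n/[n]_p!$ and $\hat e[u]_{a,p}=\sum_{n\ge0}u^n/[\hat n]_{a,p}!$. *)

(* Defs.v *)
From HB Require Import structures.
From mathcomp Require Import all_boot all_order all_fingroup all_algebra.
From mathcomp Require Import boolp.

Set Implicit Arguments.
Unset Strict Implicit.
Unset Printing Implicit Defensive.

Import Order.TTheory GRing.Theory Num.Theory.
Local Open Scope ring_scope.

Reserved Notation "{ 'fps' R }" (format "{ 'fps'  R }").

(* [f n] is the coefficient of degree [n].  Equality is extensional, thanks to
   functional extensionality. *)
Record fps (R : Type) := FPS { fps_coef :> nat -> R }.

Notation "{ 'fps' R }" := (fps R) : type_scope.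

Lemma fpsP (R : Type) (f g : {fps R}) : (forall n, f n = g n) <-> f = g.
Proof.
split=> [fg|-> //]; case: f g fg => [f] [g] /= fg.
by congr FPS; apply/funext.
Qed.

HB.instance Definition _ (R : Type) := gen_eqMixin {fps R}.
HB.instance Definition _ (R : Type) := gen_choiceMixin {fps R}.

Section FpsRing.
Variable R : comNzRingType.
Implicit Types f g h : {fps R}.

Definition fps_zero : {fps R} := FPS (fun=> 0).
Definition fps_opp f : {fps R} := FPS (fun n => - f n).
Definition fps_add f g : {fps R} := FPS (fun n => f n + g n).
Definition fps_one : {fps R} := FPS (fun n => (n == 0%N)%:R).
Definition fps_mul f g : {fps R} :=
  FPS (fun n => \sum_(i < n.+1) f i * g (n - i)%N).

Fact fps_addA : associative fps_add.
Proof. by move=> f g h; apply/fpsP=> n /=; rewrite addrA. Qed.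
Fact fps_addC : commutative fps_add.
Proof. by move=> f g; apply/fpsP=> n /=; rewrite addrC. Qed.
Fact fps_add0 : left_id fps_zero fps_add.
Proof. by move=> f; apply/fpsP=> n /=; rewrite add0r. Qed.
Fact fps_addN : left_inverse fps_zero fps_opp fps_add.
Proof. by move=> f; apply/fpsP=> n /=; rewrite addNr. Qed.

HB.instance Definition _ :=
  GRing.isZmodule.Build {fps R} fps_addA fps_addC fps_add0 fps_addN.

Definition fps_trunc N f : {poly R} := \poly_(i < N) f i.

Lemma fps_mul_trunc N f g n : (n < N)%N ->
  fps_mul f g n = (fps_trunc N f * fps_trunc N g)`_n.
Proof.
move=> ltnN; rewrite coefM; apply: eq_bigr => i _; rewrite !coef_poly.
by rewrite (leq_ltn_trans _ ltnN) ?leq_ord // (leq_ltn_trans _ ltnN) ?leq_subr.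
Qed.

Fact fps_mulC : commutative fps_mul.
Proof. by move=> f g; apply/fpsP=> n; rewrite !(@fps_mul_trunc n.+1) // mulrC. Qed.

Fact fps_mulA : associative fps_mul.
Proof.
move=> f g h; apply/fpsP=> n.
transitivity (fps_trunc n.+1 f * (fps_trunc n.+1 g * fps_trunc n.+1 h))`_n.
  rewrite coefM; apply: eq_bigr => i _.
  by rewrite coef_poly ltn_ord (@fps_mul_trunc n.+1) // ltnS leq_subr.
rewrite mulrA coefM; apply: eq_bigr => i _.
by rewrite coef_poly ltnS leq_subr -(@fps_mul_trunc n.+1).
Qed.

Fact fps_mul1 : left_id fps_one fps_mul.
Proof.
move=> f; apply/fpsP=> n /=; rewrite big_ord_recl /= mul1r subn0.
by rewrite big1 ?addr0 // => i _; rewrite mul0r.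
Qed.

Fact fps_mulDl : left_distributive fps_mul fps_add.
Proof.
move=> f g h; apply/fpsP=> n /=.
by rewrite -big_split; apply: eq_bigr => i _; rewrite mulrDl.
Qed.

Fact fps_one_neq0 : fps_one != 0.
Proof. by apply/eqP => /fpsP/(_ 0%N)/eqP; rewrite /= oner_eq0. Qed.

HB.instance Definition _ := GRing.Zmodule_isComNzRing.Build {fps R}
  fps_mulA fps_mulC fps_mul1 fps_mulDl fps_one_neq0.

Lemma coef_fps0 n : (0 : {fps R}) n = 0. Proof. by []. Qed.
Lemma coef_fps1 n : (1 : {fps R}) n = (n == 0%N)%:R. Proof. by []. Qed.
Lemma coef_fpsN f n : (- f) n = - f n. Proof. by []. Qed.
Lemma coef_fpsD f g n : (f + g) n = f n + g n. Proof. by []. Qed.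
Lemma coef_fpsM f g n : (f * g) n = \sum_(i < n.+1) f i * g (n - i)%N.
Proof. by []. Qed.

Lemma coef_fps_sum I (r : seq I) (P : pred I) (F : I -> {fps R}) n :
  (\sum_(i <- r | P i) F i) n = \sum_(i <- r | P i) F i n.
Proof. by elim/big_rec2: _ => // i x y _ <-. Qed.

Definition fpsC (c : R) : {fps R} := FPS (fun n => if n == 0%N then c else 0).

Definition fpsX : {fps R} := FPS (fun n => (n == 1%N)%:R).

(* [fps_scale c f] is f(c x). *)
Definition fps_scale (c : R) f : {fps R} := FPS (fun n => c ^+ n * f n).

Lemma coef_fpsCM c f n : (fpsC c * f) n = c * f n.
Proof.
rewrite coef_fpsM big_ord_recl /= subn0 big1 ?addr0 // => i _.
by rewrite mul0r.
Qed.

Lemma coef_fpsX_small f k n : f 0%N = 0 -> (n < k)%N -> (f ^+ k) n = 0.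
Proof.
move=> f0; elim: k n => // k IHk n; rewrite ltnS => lenk.
rewrite exprS coef_fpsM big_ord_recl /= f0 mul0r add0r big1 // => i _.
rewrite IHk ?mulr0 //; apply: leq_trans lenk.
by have := ltn_ord i; case: n i => [[]|n i _] //; rewrite subSS ltnS leq_subr.
Qed.

End FpsRing.

Section FpsUnitRing.
Variable R : comUnitRingType.
Implicit Types f g h : {fps R}.

Definition fps_unit : pred {fps R} := fun f => f 0%N \is a GRing.unit.

(* With h = 1 - f / f(0), the inverse of f is the sum of h ^ k / f(0) over k;
   as h has no constant term, only k <= n contributes in degree n.  As usual in
   MathComp, the inverse of a non-unit is itself. *)
Definition fps_inv f : {fps R} :=
  if fps_unit f then
    FPS (fun n => (fpsC (f 0%N)^-1 *
                   \sum_(k < n.+1) (1 - fpsC (f 0%N)^-1 * f) ^+ k) n)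
  else f.

Fact fps_mulVf : {in fps_unit, left_inverse 1 fps_inv *%R}.
Proof.
move=> f; rewrite -topredE /= => uf; rewrite /fps_inv uf mulrC.
set c := fpsC _; set h := 1 - c * f.
have h0 : h 0%N = 0.
  by rewrite coef_fpsD coef_fpsN coef_fpsCM coef_fps1 mulVr ?subrr.
have coef_ext m n : (m <= n)%N ->
    (c * \sum_(k < m.+1) h ^+ k) m = (c * \sum_(k < n.+1) h ^+ k) m.
  move=> lemn; rewrite !coef_fpsCM !coef_fps_sum; congr (_ * _).
  rewrite (big_ord_widen n.+1 (fun k => (h ^+ k) m)) ?ltnS // big_mkcond /=.
  apply: eq_bigr => k _; case: ltnP => // ltmk.
  by rewrite coef_fpsX_small.
apply/fpsP => n.
transitivity ((f * (c * \sum_(k < n.+1) h ^+ k)) n).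
  rewrite !coef_fpsM; apply: eq_bigr => i _; congr (_ * _).
  by apply: coef_ext; rewrite leq_subr.
have -> : f * (c * \sum_(k < n.+1) h ^+ k) = 1 - h ^+ n.+1.
  have cfE : c * f = 1 - h by rewrite /h subKr.
  by rewrite mulrA [f * c]mulrC cfE -[RHS]opprB subrX1 -mulNr (opprB h 1).
by rewrite coef_fpsD coef_fpsN coef_fpsX_small // subr0.
Qed.

Fact fps_unitP f g : g * f = 1 -> fps_unit f.
Proof.
move=> /fpsP/(_ 0%N); rewrite coef_fpsM big_ord1 /= => gf1.
by apply/unitrPr; exists (g 0%N); rewrite mulrC.
Qed.

Fact fps_inv_out : {in [predC fps_unit], fps_inv =1 id}.
Proof. by move=> f; rewrite inE /= /fps_inv -topredE /= => /negPf->. Qed.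

HB.instance Definition _ := GRing.ComNzRing_hasMulInverse.Build {fps R}
  fps_mulVf fps_unitP fps_inv_out.

End FpsUnitRing.

(* Power series in t whose coefficients are power series in u, i.e. R[[u,t]]:
    [f k m] is the coefficient of t^k u^m. *)
Section Bivariate.
Variable R : comUnitRingType.

Definition tvar : {fps {fps R}} := fpsX {fps R}.
Definition uvar : {fps {fps R}} := fpsC (fpsX R).
Definition constut (c : R) : {fps {fps R}} := fpsC (fpsC c).

(* [fps_has_sum F S]: the infinite sum of the [F n] converges to S, each
   coefficient of the partial sums being eventually that of S. *)
Definition fps_has_sum (F : nat -> {fps {fps R}}) (S : {fps {fps R}}) : Prop :=
  forall k m : nat, exists N0 : nat, forall N : nat, (N0 <= N)%N ->
    (\sum_(n < N) F n) k m = S k m.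

End Bivariate.

(* The q-Pochhammer symbol (x;p)_n. *)
Definition qpoch (R : comNzRingType) (x p : R) (n : nat) : R :=
  \prod_(i < n) (1 - x * p ^+ i).

Definition qint (R : comNzRingType) (p : R) (n : nat) : R := \sum_(i < n) p ^+ i.

Definition qfact (R : comNzRingType) (p : R) (n : nat) : R :=
  \prod_(i < n) qint p i.+1.

Definition hat_qfact (R : comNzRingType) (a p : R) (n : nat) : R :=
  qpoch (- (a * p)) p n * qfact p n.

Definition qexp (R : comUnitRingType) (p : R) : {fps R} :=
  FPS (fun n => (qfact p n)^-1).

Definition hat_qexp (R : comUnitRingType) (a p : R) : {fps R} :=
  FPS (fun n => (hat_qfact a p n)^-1).

(* The set [-n,n] \ {0}: (false, i) stands for i+1 and (true, i) for -(i+1). *)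
Definition spoint (n : nat) : finType := (bool * 'I_n)%type.

Definition spoint_val n (x : spoint n) : int := (-1) ^+ x.1 * (x.2.+1)%:Z.

Definition spoint_opp n (x : spoint n) : spoint n := (~~ x.1, x.2).

Lemma spoint_val_opp n (x : spoint n) :
  spoint_val (spoint_opp x) = - spoint_val x.
Proof. by case: x => [[] i]; rewrite /spoint_val /= ?mulN1r ?mul1r ?opprK. Qed.

Definition signed_perms (n : nat) : {set {perm spoint n}} :=
  [set beta : {perm spoint n} |
    [forall x, beta (spoint_opp x) == spoint_opp (beta x)]].

(* The integer beta(i) for 0 <= i <= n, with beta(0) = 0 (and the irrelevant
   value 0 for i > n). *)
Definition window n (beta : {perm spoint n}) (i : nat) : int :=
  if i is j.+1 then
    if insub j is Some j' then spoint_val (beta (false, j')) else 0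
  else 0.

Definition DesB n (beta : {perm spoint n}) : {set 'I_n} :=
  [set i : 'I_n | window beta i > window beta i.+1].

Definition desB n (beta : {perm spoint n}) : nat := #|DesB beta|.

Definition majB n (beta : {perm spoint n}) : nat := (\sum_(i in DesB beta) i)%N.

Definition negB n (beta : {perm spoint n}) : nat :=
  #|[set i : 'I_n | window beta i.+1 < 0]|.

(* s_0 exchanges 1 and -1; for 1 <= i <= n-1, s_i exchanges i and i+1 as well as
   -i and -(i+1). *)
Definition coxeter_gens (n : nat) : {set {perm spoint n}} :=
  [set tperm ((false, i) : spoint n) (true, i) | i : 'I_n & i == 0%N :> nat] :|:
  [set (tperm ((false, ij.1) : spoint n) (false, ij.2) *
        tperm ((true, ij.1) : spoint n) (true, ij.2))%g
     | ij : 'I_n * 'I_n & ij.2 == ij.1.+1 :> nat].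

(* [A ^+ k] is the set of products of k elements of A, so this is the least
   length of a word in A with product x.  The search is bounded because the
   prefixes of a shortest word are pairwise distinct, so that its length is less
   than #|gT|; if x is not a product of elements of A the value is #|gT|. *)
Definition word_length (gT : finGroupType) (A : {set gT}) (x : gT) : nat :=
  find (fun k => x \in (A ^+ k)%g) (iota 0 #|gT|).

Definition ellB n (beta : {perm spoint n}) : nat :=
  word_length (coxeter_gens n) beta.

(* Main.v *)
Require Import Defs.
From HB Require Import structures.
From mathcomp Require Import all_boot all_order all_fingroup all_algebra.
From mathcomp Require Import zify ring.

(** Deleting the last letter of a signed permutation and standardizing the rest
    identifies [B_(n+1)] with pairs of an element of [B_n] and a letter [v];
    if [x] in [0, 2n+1] is the number of nonzero elements of [-n-1, n+1] larger
    than [v], then the Coxeter length grows by [x], and whether [n] becomes a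
    descent depends only on [x] and on the rank of the previous last letter.
    So all four statistics are read off a sequence of such codes.

    For fixed [n] let [R_N] be the sum of the weights over the [beta] whose
    descents are all smaller than [N], and [P_N] the sum over [B_N].  Words with
    increasing letters after position [N], and no condition at [N], are
    enumerated by [P_N F], where [F = hat[n]! / (hat[N]! [n-N]!)] by the
    q-binomial theorem.  Splitting them according to whether [N] is a descent
    gives
      [R_(N+1) = (1 - t q^N) R_N + t q^N P_N F],
    which telescopes after division by [(t;q)_(N+1)].  The result,
      [V_n = 1 / hat[n]! + t sum_(i <= n) q^i V_i / [n-i]!]
    for [V_n = P_n / ((t;q)_(n+1) hat[n]!)], is the recursion in [k] of the
    coefficients of the right-hand side. *)

Set Implicit Arguments.
Unset Strict Implicit.
Unset Printing Implicit Defensive.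

Import Order.TTheory GRing.Theory Num.Theory.
Local Open Scope ring_scope.

(** * Characterization of word length by steps up and down *)

Section WordLength.
Local Open Scope nat_scope.
Local Open Scope group_scope.
Variables (gT : finGroupType) (A D : {set gT}) (L : gT -> nat).
Hypotheses (D1 : 1 \in D) (L1 : L 1 = 0).
Hypothesis step_up :
  forall x s, x \in D -> s \in A -> x * s \in D /\ L (x * s) <= (L x).+1.
Hypothesis step_down : forall x, x \in D -> x != 1 ->
  exists y s, [/\ y \in D, s \in A, x = y * s & L x = (L y).+1].

Lemma mem_expg_length k x : x \in A ^+ k -> x \in D /\ L x <= k.
Proof.
elim: k x => [|k IHk] x; first by rewrite expg0 => /set1P ->; rewrite L1.
rewrite expgSr => /mulsgP[y s /IHk[Dy Ly] As ->].
have [Dys Lys] := step_up Dy As; split=> //.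
exact: leq_trans Lys _.
Qed.

(** The second half, that [L] takes every value up to [L x], serves to bound [L x] by the order of
    the group. *)
Lemma length_descent x : x \in D ->
  x \in A ^+ L x /\ forall j, j <= L x -> exists y, L y = j.
Proof.
move: {2}(L x) (leqnn (L x)) => k; elim: k x => [|k IHk] x Lx Dx.
  have [->|nx1] := eqVneq x 1.
    by rewrite L1; split=> [|[] // _]; [rewrite expg0 set11 | exists 1].
  by have [y [s [_ _ _ Lxy]]] := step_down Dx nx1; rewrite Lxy in Lx.
have [->|nx1] := eqVneq x 1.
  by rewrite L1; split=> [|[] // _]; [rewrite expg0 set11 | exists 1].
have [y [s [Dy As def_x Lxy]]] := step_down Dx nx1.
have [|Ay Ey] := IHk y _ Dy; first by rewrite -ltnS -Lxy.
split=> [|j]; first by rewrite Lxy expgSr def_x mem_mulg.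
by rewrite leq_eqVlt => /predU1P[->|]; [exists x | rewrite Lxy ltnS => /Ey].
Qed.

(** Descending to [1] spells [x] as a word of length [L x]; no shorter word works, since each letter
    raises [L] by at most one. *)
Lemma word_lengthE x : x \in D -> word_length A x = L x.
Proof.
move=> Dx; have [Ax Ex] := length_descent Dx.
(* The search in [word_length] stops before [#|gT|]; choosing a preimage under [L] of each of
   [0, ..., L x] gives [L x + 1] distinct elements. *)
have ltL : L x < #|gT|.
  rewrite -[L x < _]/((L x).+1 <= _) -[(L x).+1]card_ord.
  have exL (j : 'I_(L x).+1) : exists y, L y == j.
    by have [y <-] := Ex j (leq_ord j); exists y.
  pose f j := xchoose (exL j).
  have fK j : L (f j) = j := eqP (xchooseP (exL j)).
  by apply: (@leq_card _ _ f) => i j fij; apply: val_inj; rewrite /= -!fK fij.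
set P := fun k => x \in A ^+ k.
have hasP : has P (iota 0 #|gT|).
  by apply/hasP; exists (L x); rewrite ?mem_iota.
have ltF := hasP; rewrite has_find size_iota in ltF.
have := nth_find 0 hasP; rewrite nth_iota // add0n => /mem_expg_length[_ leF].
apply/eqP; rewrite eqn_leq leF andbT leqNgt; apply/negP => ltLf.
by have := before_find 0 ltLf; rewrite nth_iota // add0n /P Ax.
Qed.

End WordLength.

(** * Appending and deleting the last letter of a signed permutation *)

Section Insertion.
Variable n : nat.
Implicit Types (e : bool) (c : 'I_n.+1) (beta : {perm spoint n}).

(** The last letter is [(e, c)]; [lift c] makes room for it among the absolute values of the other
    letters and keeps their signs and relative order. *)
Definition ins_fun e c beta (x : spoint n.+1) : spoint n.+1 :=
  if unlift ord_max x.2 is Some y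
  then ((beta (x.1, y)).1, lift c (beta (x.1, y)).2) else (x.1 (+) e, c).

Lemma ins_fun_inj e c beta : injective (ins_fun e c beta).
Proof.
move=> [b x] [b' x']; rewrite /ins_fun /=.
case: unliftP => [y ->|->]; case: unliftP => [y' ->|->] E;
  have := congr1 snd E; have {E} := congr1 fst E => /=.
- move=> eb ez; have /perm_inj[-> ->] // : beta (b, y) = beta (b', y').
  by rewrite [LHS]surjective_pairing eb (lift_inj ez) -surjective_pairing.
- by move=> _ /eqP; rewrite eq_sym (negPf (neq_lift _ _)).
- by move=> _ /eqP; rewrite (negPf (neq_lift _ _)).
- by move=> /addIb ->.
Qed.

Definition ins e c beta : {perm spoint n.+1} := perm (@ins_fun_inj e c beta).

Lemma ins_lift e c beta b y :
  ins e c beta (b, lift ord_max y) = ((beta (b, y)).1, lift c (beta (b, y)).2).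
Proof. by rewrite permE /ins_fun /= liftK. Qed.

Lemma ins_max e c beta b : ins e c beta (b, ord_max) = (b (+) e, c).
Proof. by rewrite permE /ins_fun /= unlift_none. Qed.

Lemma perm_spointP (f g : {perm spoint n.+1}) :
    (forall b y, f (b, lift ord_max y) = g (b, lift ord_max y)) ->
    (forall b, f (b, ord_max) = g (b, ord_max)) ->
  f = g.
Proof.
move=> fg1 fg2; apply/permP => -[b y].
by case: (unliftP ord_max y) => [z ->|->].
Qed.

Definition del_fun (beta : {perm spoint n.+1}) (x : spoint n) : spoint n :=
  let z := beta (x.1, lift ord_max x.2) in
  (z.1, odflt x.2 (unlift (beta (false, ord_max)).2 z.2)).

Lemma signed_permsP m (beta : {perm spoint m}) :
  reflect (forall b i, beta (~~ b, i) = (~~ (beta (b, i)).1, (beta (b, i)).2))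
          (beta \in signed_perms m).
Proof.
rewrite inE; apply: (iffP forallP) => [H b i|H [b i]]; last by rewrite H.
exact: (eqP (H (b, i))).
Qed.

Lemma signed_perms_max (beta : {perm spoint n.+1}) b :
  beta \in signed_perms n.+1 ->
  beta (b, ord_max) =
  (b (+) (beta (false, ord_max)).1, (beta (false, ord_max)).2).
Proof.
move/signed_permsP => sb; case: b; last exact: surjective_pairing.
by rewrite (sb false) addTb.
Qed.

(** A letter with the absolute value of the last one would be plus or minus that letter, hence the
    image of some [(_, ord_max)], against injectivity. So the default in [del_fun] is never
    reached. *)
Lemma del_funE (beta : {perm spoint n.+1}) b y : beta \in signed_perms n.+1 ->
  let z := beta (b, lift ord_max y) in
  z.2 = lift (beta (false, ord_max)).2 (del_fun beta (b, y)).2.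
Proof.
move=> sb z; rewrite /del_fun /= -/z.
case: unliftP => [//|zE].
have : z = beta (z.1 (+) (beta (false, ord_max)).1, ord_max).
  by rewrite signed_perms_max // addbK -zE -surjective_pairing.
by move/perm_inj/(congr1 snd)/eqP; rewrite eq_sym (negPf (neq_lift _ _)).
Qed.

Lemma del_fun_inj (beta : {perm spoint n.+1}) : beta \in signed_perms n.+1 ->
  injective (del_fun beta).
Proof.
move=> sb [b y] [b' y'] eq_del.
suff /perm_inj E :  beta (b, lift ord_max y) = beta (b', lift ord_max y').
  have /= -> := congr1 fst E; have /= /lift_inj -> // := congr1 snd E.
have := congr1 fst eq_del; rewrite {1 2}/del_fun /= => eq1.
rewrite [LHS]surjective_pairing [RHS]surjective_pairing eq1.
by rewrite !del_funE // eq_del.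
Qed.

(** Injectivity of [del_fun] is proved from signedness, so the proof is extracted by matching on
    [idP]; [1] is a dummy value. *)
Definition del (beta : {perm spoint n.+1}) : {perm spoint n} :=
  if @idP (beta \in signed_perms n.+1) is ReflectT sb
  then perm (del_fun_inj sb) else 1%g.

Lemma delE (beta : {perm spoint n.+1}) : beta \in signed_perms n.+1 ->
  del beta =1 del_fun beta.
Proof.
by move=> sb x; rewrite /del; case: {-}_ / idP => // sb'; rewrite permE.
Qed.

Lemma insK_last e c beta : ins e c beta (false, ord_max) = (e, c).
Proof. by rewrite ins_max addFb. Qed.

Lemma ins_signed e c beta :
  (ins e c beta \in signed_perms n.+1) = (beta \in signed_perms n).
Proof.
apply/signed_permsP/signed_permsP => sb b i.
  have := sb b (lift ord_max i); rewrite !ins_lift => E.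
  have /= e1 := congr1 fst E; have /= /lift_inj e2 := congr1 snd E.
  by rewrite [LHS]surjective_pairing e1 e2.
case: (unliftP ord_max i) => [y ->|->].
  by rewrite !ins_lift sb.
by rewrite !ins_max addNb.
Qed.

Lemma insK e c beta : beta \in signed_perms n -> del (ins e c beta) = beta.
Proof.
move=> sb; apply/permP => -[b y]; rewrite delE ?ins_signed //.
by rewrite /del_fun insK_last ins_lift /= liftK /= -surjective_pairing.
Qed.

Lemma delK (beta : {perm spoint n.+1}) : beta \in signed_perms n.+1 ->
  ins (beta (false, ord_max)).1 (beta (false, ord_max)).2 (del beta) = beta.
Proof.
move=> sb; apply: perm_spointP => b; last by rewrite ins_max -signed_perms_max.
by move=> y; rewrite ins_lift !delE // -del_funE // -surjective_pairing.
Qed.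

Lemma del_signed (beta : {perm spoint n.+1}) :
  beta \in signed_perms n.+1 -> del beta \in signed_perms n.
Proof.
by move=> sb; rewrite -(ins_signed (beta (false, ord_max)).1
                          (beta (false, ord_max)).2) delK.
Qed.

Lemma big_signed_permsS (V : zmodType) (F : {perm spoint n.+1} -> V) :
  \sum_(beta in signed_perms n.+1) F beta =
  \sum_(beta in signed_perms n)
    \sum_c (F (ins false c beta) + F (ins true c beta)).
Proof.
pose ins3 (x : {perm spoint n} * ('I_n.+1 * bool)) := ins x.2.2 x.2.1 x.1.
pose del3 (b : {perm spoint n.+1}) :=
  (del b, ((b (false, ord_max)).2, (b (false, ord_max)).1)).
rewrite (reindex_onto ins3 del3) => [|b sb]; last exact: delK.
have -> : \sum_(beta in signed_perms n)
    \sum_c (F (ins false c beta) + F (ins true c beta)) =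
    \sum_(beta in signed_perms n)
      \sum_(ce : 'I_n.+1 * bool) F (ins ce.2 ce.1 beta).
  apply: eq_bigr => beta _.
  rewrite -(pair_bigA _ (fun c e => F (ins e c beta))).
  by apply: eq_bigr => c _; rewrite big_bool addrC.
rewrite pair_big /=; apply: eq_bigl => -[b [c e]].
rewrite /ins3 /del3 /= ins_signed.
case: (boolP (b \in _)) => //= sb.
by rewrite insK // insK_last eqxx.
Qed.

End Insertion.

(** * The Coxeter generators and their effect on the last letter *)

Section Generators.
Local Open Scope group_scope.

Definition sflip n (i : 'I_n) : {perm spoint n} := tperm (false, i) (true, i).

Definition sswap n (i j : 'I_n) : {perm spoint n} :=
  tperm (false, i) (false, j) * tperm (true, i) (true, j).

Lemma sflipE n (i : 'I_n) b y : sflip i (b, y) = (b (+) (y == i), y).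
Proof.
rewrite /sflip; case: (eqVneq y i) => [->|neq].
  by case: b; rewrite ?tpermL ?tpermR.
by rewrite addbF tpermD // xpair_eqE [i == y]eq_sym (negPf neq) andbF.
Qed.

Lemma sswapE n (i j : 'I_n) b y : sswap i j (b, y) = (b, tperm i j y).
Proof.
have tE c : tperm (c, i) (c, j) (c, y) = (c, tperm i j y).
  by rewrite -(inj_tperm i j y (f := pair c)) // => ? ? [].
have tD c z : tperm (c, i) (c, j) (~~ c, z) = (~~ c, z).
  by rewrite tpermD // xpair_eqE; case: c.
rewrite /sswap permM; case: b.
  by rewrite (tD false y : _ (true, y) = _) tE.
by rewrite tE; apply: (tD true _).
Qed.

Lemma sswapC n (i j : 'I_n) : sswap i j = sswap j i.
Proof. by rewrite /sswap !(tpermC (_, i)). Qed.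

Variant coxeter_gens_spec n : {perm spoint n} -> Prop :=
  | GenFlip (i : 'I_n) of i = 0 :> nat : coxeter_gens_spec (@sflip n i)
  | GenSwap (i j : 'I_n) of j = i.+1 :> nat : coxeter_gens_spec (@sswap n i j).

Lemma coxeter_gensP n (s : {perm spoint n}) :
  reflect (coxeter_gens_spec s) (s \in coxeter_gens n).
Proof.
apply: (iffP setUP) => [[]|[i i0|i j ij]].
- by case/imsetP => i; rewrite inE => /eqP i0 ->; apply: GenFlip.
- by case/imsetP => -[i j]; rewrite inE => /eqP ij ->; apply: GenSwap.
- by left; apply/imsetP; exists i; rewrite ?inE ?i0.
- by right; apply/imsetP; exists (i, j); rewrite ?inE ?ij.
Qed.

Variables (n : nat).
Implicit Types (e : bool) (c : 'I_n.+1) (beta : {perm spoint n}).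

(** As [(b * s) x = s (b x)], multiplying on the right acts on values: a generator either moves the
    last letter or acts on the standardized rest. *)
Lemma ins_sflip e c beta : ins e c beta * sflip c = ins (~~ e) c beta.
Proof.
apply: perm_spointP => b => [y|].
  by rewrite permM !ins_lift sflipE eq_sym (negPf (neq_lift _ _)) addbF.
by rewrite permM !ins_max sflipE eqxx addbT addbN.
Qed.

Lemma ins_sflip_lift e c beta i :
  ins e c beta * sflip (lift c i) = ins e c (beta * sflip i).
Proof.
apply: perm_spointP => b => [y|].
  rewrite permM !ins_lift permM.
  by case: (beta _) => b' z; rewrite !sflipE /= (inj_eq lift_inj).
by rewrite permM !ins_max sflipE (negPf (neq_lift _ _)) addbF.
Qed.

(** No absolute value lies strictly between [c] and [d], so exchanging them leaves the
    standardization of the other letters unchanged. *)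
Lemma ins_sswap e c (d : 'I_n.+1) beta : d = c.+1 :> nat \/ c = d.+1 :> nat ->
  ins e c beta * sswap c d = ins e d beta.
Proof.
move=> cd; apply: perm_spointP => b => [y|]; last first.
  by rewrite permM !ins_max sswapE tpermL.
rewrite permM !ins_lift sswapE; congr pair.
set z := (beta (b, y)).2.
have [zd|zd] := eqVneq (lift c z) d.
  rewrite zd tpermR; apply: val_inj; move/(congr1 val): zd => /=.
  by rewrite /bump; lia.
rewrite tpermD ?neq_lift // 1?eq_sym //; apply: val_inj => /=.
have: lift c z != d :> nat by [].
by rewrite /= /bump; lia.
Qed.

Lemma ins_sswap_lift e c beta i j :
  ins e c beta * sswap (lift c i) (lift c j) = ins e c (beta * sswap i j).
Proof.
apply: perm_spointP => b => [y|].
  rewrite permM !ins_lift permM.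
  case: (beta _) => b' z; rewrite !sswapE /= (inj_tperm _ _ _ lift_inj) //.
by rewrite permM !ins_max sswapE tpermD // eq_sym neq_lift.
Qed.

End Generators.

(* The number of nonzero elements of [-n-1, n+1] larger than [(e, c)]. *)
Definition ins_code n (e : bool) (c : 'I_n.+1) : nat :=
  if e then (n + c.+1)%N else (n - c)%N.

(** * Coxeter length as a sum of codes *)

Fixpoint code_length n : {perm spoint n} -> nat :=
  match n with
  | 0 => fun=> 0
  | m.+1 => fun beta =>
      (code_length (del beta) +
       ins_code (beta (false, ord_max)).1 (beta (false, ord_max)).2)%N
  end.

Lemma code_length_ins n e (c : 'I_n.+1) beta : beta \in signed_perms n ->
  code_length (ins e c beta) = (code_length beta + ins_code e c)%N.
Proof. by move=> sb; rewrite /= insK // insK_last. Qed.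

Lemma signed_perms1 n : (1 : {perm spoint n})%g \in signed_perms n.
Proof. by apply/signed_permsP => b i; rewrite !perm1. Qed.

Lemma ins1 n : ins false ord_max (1 : {perm spoint n})%g = 1%g.
Proof.
apply: perm_spointP => b => [y|]; first by rewrite ins_lift !perm1.
by rewrite ins_max perm1 addbF.
Qed.

Lemma code_length1 n : code_length (1 : {perm spoint n})%g = 0%N.
Proof.
elim: n => // n IHn; rewrite -ins1 code_length_ins ?signed_perms1 // IHn.
by rewrite /ins_code subnn.
Qed.

Lemma signed_permsP0 (beta : {perm spoint 0}) : beta = 1%g.
Proof. by apply/permP => -[b []]. Qed.

Lemma signed_permsM n (b s : {perm spoint n}) :
  b \in signed_perms n -> s \in signed_perms n -> (b * s)%g \in signed_perms n.
Proof.
move=> /signed_permsP sb /signed_permsP ss; apply/signed_permsP => e i.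
by rewrite !permM sb ss -surjective_pairing.
Qed.

Lemma coxeter_gens_signed n s : s \in coxeter_gens n -> s \in signed_perms n.
Proof.
case/coxeter_gensP => [i _|i j _]; apply/signed_permsP => b k.
  by rewrite !sflipE addNb.
by rewrite !sswapE.
Qed.

Lemma sflip_gens n (i : 'I_n) : i = 0%N :> nat -> sflip i \in coxeter_gens n.
Proof. by move=> i0; apply/coxeter_gensP; constructor. Qed.

Lemma sswap_gens n (i j : 'I_n) : j = i.+1 :> nat \/ i = j.+1 :> nat ->
  sswap i j \in coxeter_gens n.
Proof.
by move=> ij; apply/coxeter_gensP; case: ij => ij; last rewrite sswapC;
  constructor.
Qed.

(** A generator that moves the last letter changes its code by one; any other acts on [del b] as a
    generator of the smaller group. *)
Lemma code_length_up n (b s : {perm spoint n}) :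
  b \in signed_perms n -> s \in coxeter_gens n ->
  (code_length (b * s)%g <= (code_length b).+1)%N.
Proof.
elim: n b s => [|n IHn] b s sb gs; first by [].
rewrite -(delK sb); set e := (b (false, ord_max)).1.
set c := (b (false, ord_max)).2; set b' := del b.
have sb' : b' \in signed_perms n := del_signed sb.
have ssb' s' : s' \in coxeter_gens n -> (b' * s')%g \in signed_perms n.
  by move/coxeter_gens_signed; apply: signed_permsM.
have up_lift s' : s' \in coxeter_gens n ->
    (code_length (ins e c (b' * s')%g) <= (code_length (ins e c b')).+1)%N.
  by move=> gs'; rewrite !code_length_ins ?ssb' // -addSn leq_add2r IHn.
case/coxeter_gensP: gs => [i i0|i j ij].
  case: (unliftP c i) i0 => [i' -> i0|-> c0].
    rewrite ins_sflip_lift up_lift // sflip_gens //.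
    by move: i0; rewrite /= /bump; lia.
  by rewrite ins_sflip !code_length_ins // /ins_code; case: (e) => /=; lia.
case: (unliftP c i) ij => [i' ->|->] ij; last first.
  rewrite ins_sswap; last by left.
  by rewrite !code_length_ins // /ins_code; case: (e) => /=; lia.
case: (unliftP c j) ij => [j' ->|->] ij; last first.
  rewrite sswapC ins_sswap; last by right.
  have := ltn_ord c; move: (lift c i') ij => d cd.
  by rewrite !code_length_ins // /ins_code; case: (e) => /=; lia.
rewrite ins_sswap_lift up_lift // sswap_gens //; left.
by move: ij; rewrite /= /bump; lia.
Qed.

(** A last letter that is not the largest possible is raised to the next nonzero value, which lowers
    its code by one. If it is the largest, its code is [0] and the induction hypothesis applies to
    [del b]. *)
Lemma code_length_down n (b : {perm spoint n}) : b \in signed_perms n ->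
  b != 1%g -> exists y s, [/\ y \in signed_perms n, s \in coxeter_gens n,
    b = (y * s)%g & code_length b = (code_length y).+1].
Proof.
elim: n b => [|n IHn] b sb nb1; first by rewrite (signed_permsP0 b) eqxx in nb1.
rewrite -(delK sb); set e := (b (false, ord_max)).1.
set c := (b (false, ord_max)).2; set b' := del b.
have sb' : b' \in signed_perms n := del_signed sb.
case def_e: e.
  case: (posnP c) => [c0|c_gt0].
    exists (ins false c b'), (sflip c).
    rewrite ins_signed sflip_gens // ins_sflip !code_length_ins // /ins_code.
    by split=> //; lia.
  have ltc : (c.-1 < n.+1)%N by have := ltn_ord c; lia.
  pose d := Ordinal ltc; have cd : c = d.+1 :> nat by rewrite /=; lia.
  exists (ins true d b'), (sswap d c).
  rewrite ins_signed sswap_gens ?ins_sswap ?code_length_ins //; try by left.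
  by rewrite /ins_code; split=> //; lia.
case: (ltnP c n) => [ltcn|lenc].
  have ltc : (c.+1 < n.+1)%N by [].
  pose d := Ordinal ltc; have cd : d = c.+1 :> nat by [].
  exists (ins false d b'), (sswap d c).
  rewrite ins_signed sswap_gens ?ins_sswap ?code_length_ins //; try by right.
  by rewrite /ins_code; split=> //; lia.
have cmax : c = ord_max by apply: val_inj => /=; have := ltn_ord c; lia.
have nb'1 : b' != 1%g.
  apply: contra nb1 => /eqP b'1.
  by rewrite -(delK sb) -/e -/c -/b' def_e cmax b'1 ins1.
have [y [s [sy gs -> yE]]] := IHn b' sb' nb'1.
exists (ins e c y); have sys := signed_permsM sy (coxeter_gens_signed gs).
case/coxeter_gensP: gs (yE) sys => [i i0|i j ij] yE' sys.
  exists (sflip (lift c i)); rewrite ins_signed sflip_gens /=; last first.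
    by rewrite /bump; have := ltn_ord i; lia.
  by rewrite ins_sflip_lift def_e /= !insK ?insK_last //; split=> //; lia.
exists (sswap (lift c i) (lift c j)).
rewrite ins_signed sswap_gens /=; last first.
  by left; rewrite /bump; have := ltn_ord i; have := ltn_ord j; lia.
rewrite ins_sswap_lift def_e /= !insK ?insK_last //; split=> //; lia.
Qed.

Lemma ellBE n (b : {perm spoint n}) : b \in signed_perms n ->
  ellB b = code_length b.
Proof.
apply: word_lengthE (signed_perms1 n) (code_length1 n) _ _ _.
  move=> x s sx gs; rewrite code_length_up //; split=> //.
  exact: signed_permsM sx (coxeter_gens_signed gs).
exact: code_length_down.
Qed.

Lemma ellB_ins n e (c : 'I_n.+1) (b : {perm spoint n}) : b \in signed_perms n ->
  ellB (ins e c b) = (ellB b + ins_code e c)%N.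
Proof. by move=> sb; rewrite !ellBE ?ins_signed // code_length_ins. Qed.

(** * Descents and negative letters under insertion *)

Lemma windowE n (beta : {perm spoint n}) (i : 'I_n) :
  window beta i.+1 = spoint_val (beta (false, i)).
Proof. by rewrite /window valK. Qed.

Lemma window_bound n (beta : {perm spoint n}) (i : nat) :
  - n%:Z <= window beta i <= n%:Z.
Proof.
case: i => [|i]; first by rewrite /=; lia.
case: (ltnP i n) => [ltin|lein]; last first.
  by rewrite /window insubF; [lia | rewrite ltnNge lein].
rewrite (windowE beta (Ordinal ltin)); case: (beta _) => [[] j];
have := ltn_ord j; rewrite /spoint_val /= ?expr0 ?expr1; lia.
Qed.

Lemma window_ins n e (c : 'I_n.+1) (beta : {perm spoint n}) i : (i <= n)%N ->
  let w := window beta i in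
  window (ins e c beta) i =
    if c%:Z < w then w + 1 else if w < - c%:Z then w - 1 else w.
Proof.
case: i => [|i] ltin /=; first by case: ltP => //; case: ltP => //; lia.
have liE : lift ord_max (Ordinal ltin) = i :> nat.
  by rewrite /= /bump leqNgt ltin.
rewrite -!/(window _ i.+1) -{1}liE windowE ins_lift.
have -> := windowE beta (Ordinal ltin).
case: (beta _) => [b z]; rewrite /spoint_val /= /bump.
by case: b => /=; rewrite ?expr0 ?expr1; case: ltP => //; try case: ltP => //;
  lia.
Qed.

Local Arguments window : simpl never.

Lemma window_ins_last n e (c : 'I_n.+1) (beta : {perm spoint n}) :
  window (ins e c beta) n.+1 = spoint_val (e, c).
Proof. by rewrite (windowE _ ord_max) ins_max. Qed.

Lemma desBE n (beta : {perm spoint n}) :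
  desB beta = (\sum_(i < n) (window beta i.+1 < window beta i)%R)%N.
Proof.
rewrite /desB /DesB -sum1dep_card big_mkcond /=.
by apply: eq_bigr => i _; case: ifP.
Qed.

Lemma majBE n (beta : {perm spoint n}) :
  majB beta = (\sum_(i < n) i * (window beta i.+1 < window beta i)%R)%N.
Proof.
rewrite /majB big_mkcond /=; apply: eq_bigr => i _.
by rewrite inE; case: ifP; rewrite ?muln1 ?muln0.
Qed.

Lemma negBE n (beta : {perm spoint n}) :
  negB beta = (\sum_(i < n) (window beta i.+1 < 0)%R)%N.
Proof.
rewrite /negB -sum1dep_card big_mkcond /=.
by apply: eq_bigr => i _; case: ifP.
Qed.

(* The number of elements of [-n, n] larger than the last letter of [beta],
   where [beta(0) = 0] counts as a letter. *)
Definition last_rank n (beta : {perm spoint n}) : nat :=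
  `|n%:Z - window beta n|%N.

(** The rank counts [0], which lies above the negative letters only, whereas the code skips it. *)
Lemma last_rank_ins n e (c : 'I_n.+1) (beta : {perm spoint n}) :
  last_rank (ins e c beta) = (ins_code e c + e)%N.
Proof.
rewrite /last_rank window_ins_last /spoint_val /ins_code /=.
by have := ltn_ord c; case: e => /=; rewrite ?expr0 ?expr1; lia.
Qed.

(** The [2n+2] possible letters correspond to the gaps around the [2n+1] elements of [[-n, n]]: the
    letter of code [x] falls just below the [x] largest of them. *)
Lemma ins_last_descent n e (c : 'I_n.+1) (beta : {perm spoint n}) :
  (window (ins e c beta) n.+1 < window (ins e c beta) n) =
  (last_rank beta < ins_code e c)%N.
Proof.
rewrite window_ins_last window_ins // /last_rank /spoint_val /ins_code /=.
have := window_bound beta n; have := ltn_ord c; set w := window beta n.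
have [?|?] := ltP c%:Z w; last have [?|?] := ltP w (- c%:Z);
  by case: e; rewrite /= ?expr0 ?expr1; lia.
Qed.

Lemma window_ins_lt n e (c : 'I_n.+1) (beta : {perm spoint n}) i j :
    (i <= n)%N -> (j <= n)%N ->
  (window (ins e c beta) i < window (ins e c beta) j) =
  (window beta i < window beta j).
Proof.
move=> lein lejn; rewrite !window_ins //.
move: (window beta i) (window beta j) => v w.
have [?|?] := ltP c%:Z v; last have [?|?] := ltP v (- c%:Z);
  have [?|?] := ltP c%:Z w; try (have [?|?] := ltP w (- c%:Z)); lia.
Qed.

Lemma desB_ins n e (c : 'I_n.+1) (beta : {perm spoint n}) :
  desB (ins e c beta) = (desB beta + (last_rank beta < ins_code e c))%N.
Proof.
rewrite !desBE big_ord_recr /= ins_last_descent; congr (_ + _)%N.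
by apply: eq_bigr => i _; rewrite window_ins_lt // ltnW.
Qed.

Lemma majB_ins n e (c : 'I_n.+1) (beta : {perm spoint n}) :
  majB (ins e c beta) = (majB beta + n * (last_rank beta < ins_code e c))%N.
Proof.
rewrite !majBE big_ord_recr /= ins_last_descent; congr (_ + _)%N.
by apply: eq_bigr => i _; rewrite window_ins_lt // ltnW.
Qed.

Lemma negB_ins n e (c : 'I_n.+1) (beta : {perm spoint n}) :
  negB (ins e c beta) = (negB beta + e)%N.
Proof.
rewrite !negBE big_ord_recr window_ins_last; congr (_ + _)%N; last first.
  by case: e => /=; rewrite /spoint_val /= ?expr0 ?expr1; lia.
apply: eq_bigr => i _; congr (nat_of_bool _).
(* The bound [0] is the letter in position [0], so negativity is a comparison of two letters. *)
exact: (@window_ins_lt n e c beta i.+1 0).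
Qed.

(** * Weighted sums over signed permutations, one letter at a time *)

Section WeightedSum.
Variables (K : comNzRingType) (t q p a : K).

Definition weight n (beta : {perm spoint n}) : K :=
  t ^+ desB beta * q ^+ majB beta * p ^+ ellB beta * a ^+ negB beta.

(** [phi] stands for the weight of the letters still to be appended; whether the next one creates a
    descent depends on [beta] only through [last_rank]. *)
Definition weighted_sum n (phi : nat -> K) : K :=
  \sum_(beta in signed_perms n) weight beta * phi (last_rank beta).

Lemma weighted_sum0 phi : weighted_sum 0 phi = phi 0%N.
Proof.
rewrite /weighted_sum (big_pred1 1%g) => [|beta].
  rewrite /weight desBE majBE negBE !big_ord0 ellBE ?signed_perms1 //.
  by rewrite !expr0 !mulr1 mul1r.
by rewrite (signed_permsP0 beta) signed_perms1 /= eqxx.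
Qed.

Lemma weight_ins n e (c : 'I_n.+1) (beta : {perm spoint n}) :
  beta \in signed_perms n ->
  weight (ins e c beta) = weight beta *
    ((if (last_rank beta < ins_code e c)%N then t * q ^+ n else 1) *
     p ^+ ins_code e c * a ^+ e).
Proof.
move=> sb; rewrite /weight desB_ins majB_ins negB_ins ellB_ins // !exprD.
set d := (_ < _)%N.
have -> : (if d then t * q ^+ n else 1) = t ^+ d * q ^+ (n * d).
  by case: d; rewrite ?muln1 ?muln0 ?mulr1.
move: (t ^+ desB _) (q ^+ majB _) (p ^+ ellB _) (a ^+ negB _) => x1 x2 x3 x4.
move: (t ^+ d) (q ^+ _) (p ^+ _) (a ^+ _) => y1 y2 y3 y4.
by ring.
Qed.

(* The letters [n+1-x] are positive, the letters [-(y+1)] negative. *)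
Definition append_letter n (phi : nat -> K) (b : nat) : K :=
  \sum_(x < n.+1) (if (b < x)%N then t * q ^+ n else 1) * p ^+ x * phi x +
  a * \sum_(y < n.+1) (if (b < n.+1 + y)%N then t * q ^+ n else 1) *
      p ^+ (n.+1 + y) * phi (n.+2 + y)%N.

Lemma weighted_sumS n phi :
  weighted_sum n.+1 phi = weighted_sum n (append_letter n phi).
Proof.
rewrite /weighted_sum big_signed_permsS; apply: eq_bigr => beta sb.
rewrite big_split /= /append_letter mulrDr; congr (_ + _).
  (* A positive letter has code [n - c]; reversing the order makes the code the summation index. *)
  rewrite (reindex_inj rev_ord_inj) big_distrr; apply: eq_bigr => x _ /=.
  rewrite weight_ins // last_rank_ins /ins_code /= addn0 subSS.
  rewrite subKn ?leq_ord //.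
  by rewrite expr0 mulr1 -!mulrA.
rewrite !big_distrr; apply: eq_bigr => y _ /=.
rewrite weight_ins // last_rank_ins /ins_code /= expr1.
have -> : (n + y.+1 + 1 = n.+2 + y)%N by lia.
have -> : (n + y.+1 = n.+1 + y)%N by lia.
move: (if _ then _ else _) (p ^+ _) => x z; by ring.
Qed.

End WeightedSum.

(** * Gaussian binomials and the q-binomial theorem *)

Section QBinomial.
Variables (K : comNzRingType) (p : K).

(* The Gaussian binomial coefficient of [d+j-1] and [j], that is the complete
   homogeneous symmetric polynomial of degree [j] in [1, p, ..., p^(d-1)]. *)
Fixpoint qmultichoose (j d : nat) : K :=
  if j is i.+1 then \sum_(y < d) p ^+ y * qmultichoose i y.+1 else 1.

Local Notation h := qmultichoose.

Lemma qmultichooseS j d : h j.+1 d = \sum_(y < d) p ^+ y * h j y.+1.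
Proof. by []. Qed.

Local Arguments qmultichoose : simpl never.

Lemma qmultichooseSS j d : h j.+1 d.+1 = h j.+1 d + p ^+ d * h j d.+1.
Proof. by rewrite !qmultichooseS big_ord_recr. Qed.

Lemma qmultichooseS0 j : h j.+1 0 = 0.
Proof. exact: big_ord0. Qed.

Lemma qfactS n : qfact p n.+1 = qfact p n * qint p n.+1.
Proof. exact: big_ord_recr. Qed.

Lemma qintD m n : qint p (m + n) = qint p m + p ^+ m * qint p n.
Proof.
rewrite /qint big_split_ord /= big_distrr; congr (_ + _).
by apply: eq_bigr => i _; rewrite exprD.
Qed.

(** The factorial formula for Gaussian binomials, free of division and proved from the Pascal rule
    [qmultichooseSS]. *)
Lemma qmultichoose_fact j d :
  qfact p d * qfact p j * h j d.+1 = qfact p (d + j).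
Proof.
elim: j d => [|j IHj] d; first by rewrite /qfact big_ord0 addn0 !mulr1.
elim: d => [|d IHd].
  rewrite qmultichooseSS qmultichooseS0 add0r expr0 mul1r.
  by rewrite qfactS mulrA mulrAC IHj add0n -qfactS.
have -> : qfact p (d.+1 + j.+1) =
          qfact p (d.+1 + j) * (qint p d.+1 + p ^+ d.+1 * qint p j.+1).
  by rewrite addnS qfactS -addnS qintD.
rewrite qmultichooseSS !mulrDr; congr (_ + _).
  by rewrite addSnnS -IHd (qfactS d) -!mulrA !(mulrC (qint _ _)) -!mulrA.
rewrite -(IHj d.+1) (qfactS j).
by move: (qfact _ _) (qfact _ _) (h _ _) (qint _ _) (p ^+ _) => ? ? ? ? ?; ring.
Qed.

Lemma qbinomial_theorem z m :
  \prod_(i < m) (1 + z * p ^+ i) =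
  \sum_(j < m.+1) p ^+ 'C(j, 2) * z ^+ j * h j (m - j).+1.
Proof.
elim: m => [|m IHm]; first by rewrite big_ord0 big_ord1 /= !mulr1.
rewrite big_ord_recr /= IHm mulrDr mulr1.
rewrite [RHS]big_ord_recl [X in X + _ = _]big_ord_recl /=.
rewrite -addrA; congr (_ + _).
(* The extra term [i = m] vanishes, being a multiple of [h m.+1 0]. *)
have -> : \sum_(i < m) p ^+ 'C(bump 0 i, 2) * z ^+ bump 0 i *
                          h (bump 0 i) (m - bump 0 i).+1 =
    \sum_(i < m.+1) p ^+ 'C(i.+1, 2) * z ^+ i.+1 * h i.+1 (m - i).
  rewrite big_ord_recr /= subnn qmultichooseS0 mulr0 addr0.
  by apply: eq_bigr => i _; rewrite /bump /= add1n subnSK.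
rewrite big_distrl -big_split; apply: eq_bigr => j _ /=.
have lejm : (j <= m)%N by rewrite -ltnS.
rewrite /bump add1n subSS qmultichooseSS binS bin1.
have -> : p ^+ m = p ^+ (m - j) * p ^+ j by rewrite -exprD subnK.
by rewrite exprD exprS; ring.
Qed.

End QBinomial.

Arguments qmultichoose : simpl never.

(** * Enumeration of increasing extensions *)

Section IncreasingExtension.
Variables (K : comNzRingType) (p a : K).
Local Notation h := (qmultichoose p).

(* The weighted sum over the ways to append [m] letters to an element of [B_N]
   with last letter of rank [b], without creating a descent. *)
Fixpoint incr_ext (m N b : nat) : K :=
  if m is k.+1 then
    \sum_(x < N.+1 | (x <= b)%N) p ^+ x * incr_ext k N.+1 x +
    a * \sum_(y < N.+1 | (N.+1 + y <= b)%N)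
          p ^+ (N.+1 + y) * incr_ext k N.+1 (N.+2 + y)
  else 1.

Lemma incr_extS m N b : incr_ext m.+1 N b =
  \sum_(x < N.+1 | (x <= b)%N) p ^+ x * incr_ext m N.+1 x +
  a * \sum_(y < N.+1 | (N.+1 + y <= b)%N)
        p ^+ (N.+1 + y) * incr_ext m N.+1 (N.+2 + y).
Proof. by []. Qed.

Arguments incr_ext : simpl never.

(* All codes of a letter appended to an element of [B_N] are at most [2N+1], so
   this allows a descent at position [N]. *)
Definition free_ext (m N : nat) : K := incr_ext m N (N + N.+1).

(** All appended letters are positive here, so their codes form a weakly decreasing sequence bounded
    by [b]. *)
Lemma incr_ext_pos m N b : (b <= N)%N -> incr_ext m N b = h m b.+1.
Proof.
elim: m N b => // m IHm N b lebN; rewrite incr_extS.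
rewrite [X in a * X]big_pred0 => [|y]; last first.
  by apply/negbTE; rewrite -ltnNge; lia.
rewrite mulr0 addr0 qmultichooseS.
rewrite (big_ord_widen N.+1 (fun y => p ^+ y * h m y.+1)) ?ltnS //.
by apply: eq_bigr => x lexb; rewrite IHm //; lia.
Qed.

(** The index [j] counts the negative letters, which come first. Their codes are [N+i+y_i] for
    [i = 1, ..., j], with [d > y_1 >= ... >= y_j], which gives [h j d]; the [m - j] positive letters
    then start from the full range of codes [0, ..., N+j]. *)
Lemma incr_ext_neg m N d : (d <= N.+1)%N ->
  incr_ext m N (N + d) =
  \sum_(j < m.+1) a ^+ j * p ^+ (N * j + 'C(j.+1, 2)) *
                   h j d * h (m - j) (N + j).+1.
Proof.
elim: m N d => [|m IHm] N d ledN.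
  by rewrite big_ord1 /= muln0 !mulr1.
rewrite incr_extS big_ord_recl /= muln0 !mul1r addn0; congr (_ + _).
  rewrite subn0 qmultichooseS big_mkcond; apply: eq_bigr => x _.
  have lexN : (x <= N)%N := leq_ord x.
  by rewrite ifT ?incr_ext_pos ?(leq_trans lexN) ?leq_addr.
transitivity (a * \sum_(y < d) p ^+ (N.+1 + y) * incr_ext m N.+1 (N.+1 + y.+1)).
  pose F y := p ^+ (N.+1 + y) * incr_ext m N.+1 (N.+1 + y.+1).
  congr (_ * _); rewrite (big_ord_widen N.+1 F) // /F.
  apply: eq_big => [y|y _]; last by rewrite addnS.
  by lia.
transitivity (\sum_(y < d) \sum_(j < m.+1) a * (p ^+ (N.+1 + y) *
    (a ^+ j * p ^+ (N.+1 * j + 'C(j.+1, 2)) *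
     h j y.+1 * h (m - j) (N.+1 + j).+1))).
  rewrite big_distrr; apply: eq_bigr => y _ /=.
  by rewrite IHm ?big_distrr /= ?big_distrr //; have := ltn_ord y; lia.
rewrite exchange_big /=; apply: eq_bigr => j _.
rewrite /bump add1n subSS addnS -addSn.
rewrite qmultichooseS big_distrr big_distrl /=.
apply: eq_bigr => y _; rewrite (binS j.+1) bin1 mulnS.
have -> : (N + N * j + ('C(j.+1, 2) + j.+1) =
           N.+1 + (N.+1 * j + 'C(j.+1, 2)))%N by lia.
rewrite (exprS a) (exprD p N.+1 y) (exprD p N.+1 (_ + _)).
move: (a ^+ j) (p ^+ N.+1) (p ^+ (_ + _)) (p ^+ y) (h _ _) (h _ _).
by move=> *; ring.
Qed.

Lemma free_ext_fact m N :
  qfact p N * qfact p m * free_ext m N =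
  (\prod_(i < m) (1 + a * p ^+ (N.+1 + i))) * qfact p (N + m).
Proof.
rewrite /free_ext incr_ext_neg // big_distrr /=.
have -> : \prod_(i < m) (1 + a * p ^+ (N.+1 + i)) =
          \prod_(i < m) (1 + a * p ^+ N.+1 * p ^+ i).
  by apply: eq_bigr => i _; rewrite exprD mulrA.
rewrite qbinomial_theorem big_distrl; apply: eq_bigr => j _ /=.
have lejm : (j <= m)%N by rewrite -ltnS.
(* In binomial form: [[N+j, j] [N+m, m-j] = [N+m, m] [m, j]], and [[m, j]] is the coefficient in the
   q-binomial theorem at [z = a p^(N+1)]. *)
have := qmultichoose_fact p (m - j) (N + j).
have := qmultichoose_fact p j N; have := qmultichoose_fact p j (m - j).
rewrite -addnA subnKC // subnK // => <- E1 <-.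
rewrite -E1 binS bin1 exprMn -exprM.
have -> : (N * j + ('C(j, 2) + j) = 'C(j, 2) + N.+1 * j)%N by lia.
by rewrite exprD; ring.
Qed.

Lemma hat_free_ext m N :
  hat_qfact a p N * qfact p m * free_ext m N = hat_qfact a p (N + m).
Proof.
rewrite /hat_qfact -!mulrA [qfact p N * (_ * _)]mulrA free_ext_fact mulrA.
congr (_ * _).
rewrite /qpoch big_split_ord /=; congr (_ * _); apply: eq_bigr => i _.
by rewrite !addSn exprS exprD; ring.
Qed.

End IncreasingExtension.
Arguments incr_ext : simpl never.


(** * Splitting according to a descent at position [N] *)

Section PeelOff.
Variables (K : comNzRingType) (t q p a : K).

(** With [c = t q^N], letters creating a descent weigh [c] and the others [1 = (1 - c) + c]; the [c]
    parts together run over all letters. *)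
Lemma append_incr_ext m N b :
  append_letter t q p a N (incr_ext p a m N.+1) b =
  (1 - t * q ^+ N) * incr_ext p a m.+1 N b + t * q ^+ N * free_ext p a m.+1 N.
Proof.
rewrite /free_ext /append_letter !incr_extS; set c := t * q ^+ N.
have sum_if (z : nat -> nat) (F : nat -> K) :
    (forall x, (x < N.+1)%N -> (z x <= N + N.+1)%N) ->
    \sum_(x < N.+1) (if (b < z x)%N then c else 1) * p ^+ (z x) * F x =
    (1 - c) * (\sum_(x < N.+1 | (z x <= b)%N) p ^+ z x * F x) +
    c * (\sum_(x < N.+1 | (z x <= N + N.+1)%N) p ^+ z x * F x).
  move=> lez; rewrite !big_distrr /=.
  rewrite [X in _ = X + _]big_mkcond [X in _ = _ + X]big_mkcond.
  rewrite -big_split.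
  apply: eq_bigr => x _; rewrite lez //= ltnNge.
  by case: (z x <= b)%N => /=; ring.
rewrite (sum_if id) => [|x]; last by lia.
rewrite (sum_if (addn N.+1) (fun y => incr_ext p a m N.+1 (N.+2 + y)));
  last by move=> x; lia.
by ring.
Qed.

Definition perm_poly n : K := weighted_sum t q p a n (fun=> 1).

(** For [n = N + m + 1] this is the recursion of [R_N], which is
    [weighted_sum N (incr_ext (n - N) N)]. *)
Lemma weighted_sum_incr_ext m N :
  weighted_sum t q p a N.+1 (incr_ext p a m N.+1) =
  (1 - t * q ^+ N) * weighted_sum t q p a N (incr_ext p a m.+1 N) +
  t * q ^+ N * free_ext p a m.+1 N * perm_poly N.
Proof.
rewrite weighted_sumS /perm_poly /weighted_sum !big_distrr -big_split /=.
apply: eq_bigr => beta _; rewrite append_incr_ext.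
move: (weight _ _ _ _ _) (incr_ext _ _ _ _ _) (free_ext _ _ _ _) => ? ? ?.
by ring.
Qed.

End PeelOff.

(** * Telescoping to the recursion for [V_n] *)

Section Telescope.
Variables (K : comUnitRingType) (t q p a : K).
Hypothesis unit_t : forall n, qpoch t q n \is a GRing.unit.
Local Notation P := (perm_poly t q p a).

Lemma qpochS (x r : K) n : qpoch x r n.+1 = qpoch x r n * (1 - x * r ^+ n).
Proof. exact: big_ord_recr. Qed.

Lemma telescope_incr_ext n N : (N <= n)%N ->
  weighted_sum t q p a N (incr_ext p a (n - N) N) / qpoch t q N =
  1 + t * \sum_(i < N) q ^+ i * (P i / qpoch t q i.+1) * free_ext p a (n - i) i.
Proof.
elim: N => [|N IHN] ltNn.
  (* [R_0 = 1]: starting from rank [0] leaves [h n 1], which is [1]. *)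
  rewrite weighted_sum0 big_ord0 mulr0 addr0 incr_ext_pos //.
  rewrite /qpoch big_ord0 divr1; elim: (n - 0)%N => // m IHm.
  by rewrite qmultichooseSS qmultichooseS0 add0r expr0 mul1r.
rewrite big_ord_recr /= mulrDr addrA -IHN; last exact: ltnW.
rewrite weighted_sum_incr_ext subnSK // mulrDl; congr (_ + _); last by ring.
have uq := unit_t N.+1; rewrite qpochS unitrM in uq; case/andP: uq => uN u1.
by rewrite qpochS invrM // mulrACA divrr // mul1r.
Qed.

(** At [N = n] the left side is [P_n / (t;q)_n], that is [(1 - t q^n) P_n / (t;q)_(n+1)]; the part
    moved to the right becomes the term [i = n]. *)
Lemma perm_poly_rec n :
  P n / qpoch t q n.+1 =
  1 + t * \sum_(i < n.+1)
    q ^+ i * (P i / qpoch t q i.+1) * free_ext p a (n - i) i.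
Proof.
have := telescope_incr_ext (leqnn n); rewrite subnn => E0.
have {E0}E : P n / qpoch t q n = _ := E0.
rewrite big_ord_recr /= mulrDr addrA -E subnn.
have -> : free_ext p a 0 n = 1 by [].
rewrite mulr1.
have uq := unit_t n.+1; rewrite qpochS unitrM in uq; case/andP: uq => uN u1.
rewrite qpochS invrM //.
set d := 1 - _ in u1 *.
have -> : t * (q ^+ n * (P n * (d^-1 / qpoch t q n))) =
   (1 - d) * (P n * (d^-1 / qpoch t q n)) by rewrite /d; ring.
rewrite mulrBl mul1r [d * _]mulrCA [d * _]mulrA divrr // mul1r.
by rewrite addrC subrK.
Qed.

Hypothesis unit_hat : forall n, hat_qfact a p n \is a GRing.unit.

Lemma qfact_unit n : qfact p n \is a GRing.unit.
Proof. by have := unit_hat n; rewrite unitrM => /andP[]. Qed.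

Lemma normalized_perm_poly_rec n :
  P n / qpoch t q n.+1 / hat_qfact a p n =
  (hat_qfact a p n)^-1 + t * \sum_(i < n.+1)
    q ^+ i * (P i / qpoch t q i.+1 / hat_qfact a p i) / qfact p (n - i).
Proof.
rewrite perm_poly_rec mulrDl mul1r -mulrA big_distrl; congr (_ + _ * _).
apply: eq_bigr => i _ /=; have lein : (i <= n)%N := leq_ord i.
have := hat_free_ext p a (n - i) i; rewrite subnKC // => Eh.
have uf := qfact_unit (n - i).
have -> : free_ext p a (n - i) i =
    hat_qfact a p n / hat_qfact a p i / qfact p (n - i).
  rewrite -Eh; set x := hat_qfact a p i; set y := qfact p (n - i) in uf *.
  have ux : x \is a GRing.unit := unit_hat i.
  move: (free_ext p a _ _) => z.
  have -> : x * y * z / x / y = (x / x) * (y / y) * z by ring.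
  by rewrite !divrr // !mul1r.
set H := hat_qfact a p n; have uH : H \is a GRing.unit := unit_hat n.
move: (q ^+ i) (P i / _) (hat_qfact a p i)^-1 (qfact p _)^-1 => x y z w.
have -> : x * y * (H * z * w) / H = (H / H) * (x * (y * z) * w) by ring.
by rewrite divrr // mul1r.
Qed.

End Telescope.

(** * Ring morphisms and coefficient rules for power series *)

Section FpsMorphisms.
Variable R : comNzRingType.
Implicit Types (c : R) (f g : {fps R}).

Fact fpsC_is_zmod_morphism : zmod_morphism (@fpsC R).
Proof. by move=> x y; apply/fpsP => -[|n]; rewrite //= subr0. Qed.

Fact fpsC_is_monoid_morphism : monoid_morphism (@fpsC R).
Proof.
split=> [|x y]; apply/fpsP => -[|n] //; first by rewrite coef_fpsCM.
by rewrite coef_fpsCM /= mulr0.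
Qed.

HB.instance Definition _ :=
  GRing.isZmodMorphism.Build R {fps R} (@fpsC R) fpsC_is_zmod_morphism.
HB.instance Definition _ :=
  GRing.isMonoidMorphism.Build R {fps R} (@fpsC R) fpsC_is_monoid_morphism.

Lemma coef_fpsXM f n : (fpsX R * f) n = if n is m.+1 then f m else 0.
Proof.
rewrite coef_fpsM big_ord_recl /= mul0r add0r.
case: n => [|n]; first by rewrite big_ord0.
rewrite big_ord_recl /= mul1r subSS subn0 big1 ?addr0 // => i _.
by rewrite mul0r.
Qed.

Lemma coef_fpsXnM k f n :
  (fpsX R ^+ k * f) n = if (n < k)%N then 0 else f (n - k)%N.
Proof.
elim: k n => [|k IHk] n; first by rewrite expr0 mul1r subn0.
by rewrite exprS -mulrA coef_fpsXM; case: n => // n; rewrite IHk ltnS subSS.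
Qed.

Lemma coef_fpsXnC k c n : (fpsX R ^+ k * fpsC c) n = if n == k then c else 0.
Proof. by rewrite coef_fpsXnM /= subn_eq0; case: ltngtP. Qed.

Fact fps_scale_is_zmod_morphism c : zmod_morphism (fps_scale c).
Proof. by move=> f g; apply/fpsP => n; rewrite /= mulrBr. Qed.

Fact fps_scale_is_monoid_morphism c : monoid_morphism (fps_scale c).
Proof.
split=> [|f g]; apply/fpsP => n.
  by case: n => [|n]; rewrite /= ?mulr1 ?mulr0.
transitivity (c ^+ n * (f * g) n) => //.
rewrite !coef_fpsM big_distrr; apply: eq_bigr => i _ /=.
by rewrite -{1}(subnKC (leq_ord i)) exprD mulrACA.
Qed.

HB.instance Definition _ c :=
  GRing.isZmodMorphism.Build {fps R} {fps R} (fps_scale c)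
    (fps_scale_is_zmod_morphism c).
HB.instance Definition _ c :=
  GRing.isMonoidMorphism.Build {fps R} {fps R} (fps_scale c)
    (fps_scale_is_monoid_morphism c).

Lemma fps_scaleA c d f : fps_scale c (fps_scale d f) = fps_scale (c * d) f.
Proof. by apply/fpsP => n; rewrite /= exprMn mulrA. Qed.

Lemma fps_scale1 f : fps_scale 1 f = f.
Proof. by apply/fpsP => n; rewrite /= expr1n mul1r. Qed.

End FpsMorphisms.

HB.instance Definition _ (R : comUnitRingType) :=
  GRing.RMorphism.copy (@constut R) (@fpsC {fps R} \o @fpsC R).

Lemma rmorph_hat_qfact (R S : comNzRingType) (f : {rmorphism R -> S})
    (a p : R) n :
  f (hat_qfact a p n) = hat_qfact (f a) (f p) n.
Proof.
rewrite rmorphM !rmorph_prod; congr (_ * _); apply: eq_bigr => i _.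
  by rewrite rmorphB rmorph1 rmorphM rmorphN rmorphM rmorphXn.
by rewrite rmorph_sum; apply: eq_bigr => j _; rewrite rmorphXn.
Qed.

Lemma rmorph_qfact (R S : comNzRingType) (f : {rmorphism R -> S}) (p : R) n :
  f (qfact p n) = qfact (f p) n.
Proof.
rewrite rmorph_prod; apply: eq_bigr => i _.
by rewrite rmorph_sum; apply: eq_bigr => j _; rewrite rmorphXn.
Qed.

(** Keeping the coefficients of the recursion as images under [f] lets them be read off as constants
    once [K] is the ring of bivariate series. *)
Lemma rmorph_perm_poly_rec (R K : comUnitRingType) (f : {rmorphism R -> K})
    (t : K) (a p q : R) :
    (forall n, hat_qfact a p n \is a GRing.unit) ->
    (forall n, qpoch t (f q) n \is a GRing.unit) ->
    let V n := perm_poly t (f q) (f p) (f a) n / qpoch t (f q) n.+1 /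
               f (hat_qfact a p n) in
  forall n, V n = f (hat_qfact a p n)^-1 +
                  t * \sum_(i < n.+1) f (q ^+ i / qfact p (n - i)) * V i.
Proof.
move=> unit_hat unit_t V n.
have uf m : hat_qfact (f a) (f p) m \is a GRing.unit.
  by rewrite -rmorph_hat_qfact rmorph_unit.
rewrite /V !rmorph_hat_qfact normalized_perm_poly_rec // rmorphV //.
rewrite rmorph_hat_qfact; congr (_ + _ * _); apply: eq_bigr => i _.
rewrite rmorphM rmorphV ?(qfact_unit unit_hat) // rmorphXn rmorph_qfact.
by rewrite rmorph_hat_qfact mulrAC.
Qed.

Lemma qpoch_fpsX_unit (R : comUnitRingType) (x : {fps R}) n :
  qpoch (fpsX R) x n \is a GRing.unit.
Proof.
apply: rpred_prod => i _.
change (fps_unit (1 - fpsX R * x ^+ i)).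
by rewrite /fps_unit coef_fpsD coef_fpsN coef_fpsXM subr0 unitr1.
Qed.

Lemma eq_fps_has_sum (R : comUnitRingType) (F G : nat -> {fps {fps R}}) S :
  F =1 G -> fps_has_sum G S -> fps_has_sum F S.
Proof.
move=> eqFG sumG k m; have [N0 sumN] := sumG k m.
by exists N0 => N leN; rewrite (eq_bigr (fun i : 'I_N => G i)) ?sumN.
Qed.

(** * Comparison of the coefficients of both sides *)

Section Coefficients.
Variables (R : comUnitRingType) (a p q : R).
Hypothesis hat_unit : forall n : nat, hat_qfact a p n \is a GRing.unit.

Definition rhs_coef k : {fps R} :=
  (\prod_(j < k) fps_scale (q ^+ j) (qexp p)) *
  fps_scale (q ^+ k) (hat_qexp a p).

(** Replacing [u] by [qu] shifts every scale by one; the missing factor is the one at [j = 0]. *)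
Lemma rhs_coefS k : rhs_coef k.+1 = fps_scale q (rhs_coef k) * qexp p.
Proof.
rewrite /rhs_coef big_ord_recl fps_scale1 rmorphM rmorph_prod /=.
rewrite fps_scaleA -exprS [RHS]mulrC -mulrA; congr (_ * (_ * _)).
by apply: eq_bigr => i _; rewrite fps_scaleA -exprS.
Qed.

Lemma rhs_coef0 n : rhs_coef 0 n = (hat_qfact a p n)^-1.
Proof. by rewrite /rhs_coef big_ord0 mul1r fps_scale1. Qed.

Lemma rhs_coef_rec k n : rhs_coef k.+1 n =
  \sum_(i < n.+1) q ^+ i * rhs_coef k i / qfact p (n - i).
Proof. by rewrite rhs_coefS coef_fpsM. Qed.

Local Notation t := (tvar R).
Local Notation C := (@constut R).

Definition lhs_series n :=
  perm_poly t (C q) (C p) (C a) n / qpoch t (C q) n.+1 / C (hat_qfact a p n).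

Lemma lhs_series_rec n : lhs_series n = C (hat_qfact a p n)^-1 +
  t * \sum_(i < n.+1) C (q ^+ i / qfact p (n - i)) * lhs_series i.
Proof.
exact: (@rmorph_perm_poly_rec _ _ (@constut R) t a p q hat_unit
  (qpoch_fpsX_unit _)).
Qed.

(** The factor [t] in [lhs_series_rec] makes the coefficients of degree [k.+1] depend on those of
    degree [k] only, exactly as in [rhs_coef_rec]. *)
Lemma coef_lhs_series n k : lhs_series n k = fpsC (rhs_coef k n).
Proof.
elim: k n => [|k IHk] n; rewrite lhs_series_rec coef_fpsD coef_fpsXM.
  by rewrite addr0 rhs_coef0.
rewrite [X in X + _]/= add0r coef_fps_sum rhs_coef_rec rmorph_sum.
apply: eq_bigr => i _; rewrite coef_fpsCM IHk -rmorphM.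
by congr fpsC; rewrite mulrAC.
Qed.

Lemma lhs_has_sum :
  fps_has_sum (fun n => uvar R ^+ n * lhs_series n) (FPS rhs_coef).
Proof.
have coef_term n k m :
    (uvar R ^+ n * lhs_series n) k m = if m == n then rhs_coef k n else 0.
  by rewrite -rmorphXn coef_fpsCM coef_lhs_series coef_fpsXnC.
(* Only the term [n = m] contributes to [u^m], so partial sums are stable once they contain it. *)
move=> k m; exists m.+1 => N ltmN; rewrite 2!coef_fps_sum.
rewrite (bigD1 (Ordinal ltmN)) // big1 => [|n neq_nm].
  by rewrite [LHS]addr0 coef_term eqxx.
by rewrite coef_term eq_sym -[_ == m]/(n == Ordinal ltmN) (negPf neq_nm).
Qed.

Lemma rhs_has_sum :
  fps_has_sum (fun k => t ^+ k * fpsC (rhs_coef k)) (FPS rhs_coef).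
Proof.
move=> k m; exists k.+1 => N ltkN; rewrite 2!coef_fps_sum.
rewrite (bigD1 (Ordinal ltkN)) // big1 => [|n neq_nk].
  by rewrite [LHS]addr0 coef_fpsXnC eqxx.
by rewrite coef_fpsXnC eq_sym -[_ == k]/(n == Ordinal ltkN) (negPf neq_nk).
Qed.

End Coefficients.

Theorem theorem5p1 (R : comUnitRingType) (a p q : R)
    (hat_unit : forall n : nat, hat_qfact a p n \is a GRing.unit) :
  exists S : {fps {fps R}},
    fps_has_sum
      (fun n : nat =>
         uvar R ^+ n
           / (qpoch (tvar R) (constut q) n.+1 * constut (hat_qfact a p n))
         * \sum_(beta in signed_perms n)
             tvar R ^+ desB beta * constut q ^+ majB beta
               * constut p ^+ ellB beta * constut a ^+ negB beta)
      S
    /\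
    fps_has_sum
      (fun k : nat =>
         tvar R ^+ k
         * (\prod_(j < k) fpsC (fps_scale (q ^+ j) (qexp p)))
         * fpsC (fps_scale (q ^+ k) (hat_qexp a p)))
      S.
Proof.
exists (FPS (rhs_coef a p q)); split.
  apply: eq_fps_has_sum (lhs_has_sum q hat_unit) => n.
  rewrite /lhs_series /perm_poly /weighted_sum invrM.
  - under [in RHS]eq_bigr => beta _ do rewrite mulr1.
    by rewrite -mulrA; congr (_ * _); rewrite mulrC mulrA mulrAC.
  - exact: qpoch_fpsX_unit.
  - exact: rmorph_unit (hat_unit n).
apply: eq_fps_has_sum (rhs_has_sum a p q) => k.
by rewrite rmorphM rmorph_prod mulrA.
Qed.
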